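(* Let $K$ be a compact convex body in the hyperbolic plane. (1) For every ideal point $X\in\mathcal I$ and every point $O$ in the interior of $K$, $\mathrm{width}_K(X)\ge \mathrm{width}_3(X)$, where $\mathrm{width}_3$ is taken with respect to the origin $O$. (2) For every $X\in\mathcal I$ one can choose a point $z(X)$ on the boundary of $K$ (with a supporting line of $K$ at it) for which $\mathrm{width}_K(X)\ge \mathrm{width}_1(z(X))$. (3) If $K$ is strictly convex and smooth, then there is a homeomorphism $\varphi:\mathcal I\to \mathrm{bd}(K)$, $\varphi(X)=z(X)$, such that $\mathrm{width}_K(X)\ge \mathrm{width}_1(\varphi(X))$ for every $X\in\mathcal I$.
   Context: The hyperbolic plane has curvature $-1$; $\mathcal I$ denotes the set of its ideal points (with the topology of the boundary circle in a disk model). A compact convex body is a compact convex set with nonempty interior. For distinct $X,Y\in\mathcal I$, $YX$ denotes the hyperbolic line with ideal endpoints $Y$ and $X$. If $YX$ meets $K$, there are two hypercycles (distance curves) with leading line $YX$, one on each side of it (possibly degenerating to $YX$ itself), which touch $K$ and such that the strip between them contains $K$. Let $d_K^+(YX)$ and $d_K^-(YX)$ be the distances of these two hypercycles from $YX$; that is, $d_K^{\pm}(YX)$ is the maximal distance from $YX$ of a point of $K$ in the respective closed half-plane bounded by $YX$. Put $d_K(YX)=d_K^+(YX)+d_K^-(YX)$. The width of $K$ in the direction $X\in\mathcal I$ is $$\mathrm{width}_K(X)=\sup\{d_K(YX): Y\in\mathcal I\setminus\{X\},\ YX\cap K\neq\emptyset\}.$$ $\mathrm{width}_3$ (Leichtweiss):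 for an origin $O$ in the interior of $K$, $\mathrm{width}_3(X)$ is the width $d_K(\ell)$ of the supporting strip of $K$ bounded by hypercycles whose leading line $\ell$ is the line containing the half-line from $O$ to the ideal point $X$. $\mathrm{width}_1$ (Santaló): for a boundary point $z$ of $K$ let $L_z$ be the supporting line of $K$ at $z$ (a chosen one if it is not unique) and $L_z^\bot$ the line orthogonal to $L_z$ at $z$. Let $L_v$ be the other supporting line of $K$ orthogonal to $L_z^\bot$. Then $\mathrm{width}_1(z)$ is the hyperbolic distance between $L_z$ and $L_v$, i.e. the length of the segment of $L_z^\bot$ joining them. *)

(* Defs.v *)
From HB Require Import structures.
From mathcomp Require Import all_boot all_order all_algebra.
From mathcomp Require Import all_classical all_reals all_analysis.

Set Implicit Arguments.
Unset Strict Implicit.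
Unset Printing Implicit Defensive.

Import Order.TTheory GRing.Theory Num.Theory.
Import numFieldTopology.Exports numFieldNormedType.Exports.

Local Open Scope classical_set_scope.
Local Open Scope ring_scope.

(* The hyperbolic plane is the Beltrami-Klein disk: points are those of the
   open Euclidean unit disk of R^2, ideal points those of the unit circle, and
   hyperbolic lines and segments are Euclidean chords and segments.  On the
   open disk the hyperbolic and Euclidean topologies agree, so compactness,
   interior and closure below are those of R * R. *)

Notation plane R := (R * R)%type.

Section Klein.
Context {R : realType}.
Implicit Types (p q r u v z O X Y : plane R) (A B K L N : set (plane R)).

Definition dotp u v : R := u.1 * v.1 + u.2 * v.2.

Definition cross u v : R := u.1 * v.2 - u.2 * v.1.

Definition hplane : set (plane R) := [set p | dotp p p < 1].

Definition ideal : set (plane R) := [set X | dotp X X = 1].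

Definition arcosh (t : R) : R := ln (t + Num.sqrt (t ^+ 2 - 1)).

(* The distance of curvature -1 in the Klein model. *)
Definition hdist p q : R :=
  arcosh ((1 - dotp p q) / Num.sqrt ((1 - dotp p p) * (1 - dotp q q))).

(* The Riemannian metric of the Klein model at p; it differs from the Euclidean
   one also conformally, so that right angles must be measured with it. *)
Definition kmetric p u v : R :=
  dotp u v / (1 - dotp p p) + dotp p u * dotp p v / (1 - dotp p p) ^+ 2.

Definition set_hdist A B : R := inf [set hdist p q | p in A & q in B].

Definition hline Y X : set (plane R) :=
  [set (1 - t) *: Y + t *: X | t in `]0, 1[].

Definition is_line L : Prop :=
  exists Y X, [/\ ideal Y, ideal X, Y <> X & L = hline Y X].

(* Half-line from the point O (included) to the ideal point X. *)
Definition ray O X : set (plane R) :=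
  [set (1 - t) *: O + t *: X | t in `[0, 1[].

(* Closed half-plane on the left of the line directed from Y to X; the other
   closed half-plane bounded by this line is [halfplane X Y]. *)
Definition halfplane Y X : set (plane R) :=
  [set p | hplane p /\ 0 <= cross (X - Y) (p - Y)].

Definition perp_at p L N : Prop :=
  [/\ is_line L, is_line N, L p, N p &
    forall q r, L q -> N r -> kmetric p (q - p) (r - p) = 0].

Definition perp L N : Prop := exists p, perp_at p L N.

Definition convex_body K : Prop :=
  [/\ K `<=` hplane, compact K, convex_set K & interior K !=set0].

Definition bd K : set (plane R) := closure K `\` interior K.

Definition strictly_convex K : Prop :=
  forall p q (t : R), K p -> K q -> p <> q -> 0 < t < 1 ->
    interior K ((1 - t) *: p + t *: q).

Definition supporting K L : Prop :=
  exists Y X, [/\ ideal Y, ideal X, Y <> X, L = hline Y X &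
    K `<=` halfplane Y X /\ K `&` L !=set0].

Definition supporting_at K z L : Prop := [/\ supporting K L, K z & L z].

Definition smooth_body K : Prop :=
  forall z, bd K z -> exists! L, supporting_at K z L.

(* Greatest distance from the line YX of a point of K in [halfplane Y X];
   meant for lines YX that meet K. *)
Definition side_dist K Y X : R :=
  sup [set set_hdist [set p] (hline Y X) | p in K `&` halfplane Y X].

(* d_K(YX) = d_K^+(YX) + d_K^-(YX) *)
Definition strip_width K Y X : R := side_dist K Y X + side_dist K X Y.

Definition width K X : R :=
  sup [set strip_width K Y X | Y in
        [set Y | [/\ ideal Y, Y <> X & hline Y X `&` K !=set0]]].

(* Ideal point Y such that YX is the line containing the half-line OX. *)
Definition other_end O X : plane R :=
  xget X [set Y | [/\ ideal Y, Y <> X & ray O X `<=` hline Y X]].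

(* The width of Leichtweiss with respect to the origin O. *)
Definition width3 K O X : R := strip_width K (other_end O X) X.

(* For a line L supporting K at z: the supporting line of K, other than L,
   orthogonal to the line N that is orthogonal to L at z. *)
Definition opposite_support K z L : set (plane R) :=
  xget set0 [set L' | [/\ supporting K L', L' <> L &
    exists N, perp_at z L N /\ perp L' N]].

(* The width of Santalo at z for the supporting line L of K at z. *)
Definition width1 K z L : R := set_hdist L (opposite_support K z L).

(* A and B carry their subspace topologies. *)
Definition homeo_between A B (f : plane R -> plane R) : Prop :=
  [/\ set_bij A B f, {within A, continuous f} &
    exists g : plane R -> plane R,
      {within B, continuous g} /\ {in A, cancel f g}].

End Klein.

(* Main.v *)
(** The supporting line YX of K issuing from X with K on its left, touching K
    at z(X), itself competes in the supremum that defines width_K(X).  Its strip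
    is at least as wide as the distance from YX to a point v of K, and if v lies
    on the other supporting line occurring in width_1(z(X)) then this distance
    is at least that between the two lines.  If K is strictly convex and smooth,
    X and z(X) determine each other; since "zX supports K at z" is a closed
    relation between two compact sets, X |-> z(X) is a homeomorphism. *)

Require Import Defs.
From mathcomp Require Import all_boot all_order all_algebra.
From mathcomp Require Import all_classical all_reals all_analysis.
From mathcomp Require Import ring lra.
Set Implicit Arguments.
Unset Strict Implicit.
Unset Printing Implicit Defensive.

Import Order.TTheory GRing.Theory Num.Theory.
Import numFieldTopology.Exports numFieldNormedType.Exports.
Local Open Scope classical_set_scope.
Local Open Scope ring_scope.

(** * Continuity from a closed graph *)

(** If continuity failed at [x] for a neighbourhood [V] of [f x], the points of [A] near [x] with
    value outside [V] would have images forming a proper filter in the compact [B]. It clusters at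
    some [y]; closedness of [G] forces [y = f x], yet the filter avoids [V]. *)
Lemma closed_graph_within_continuous (T U : topologicalType) (A : set T)
    (B : set U) (G : set (T * U)) (f : T -> U) :
  compact B -> closed G -> (forall x, A x -> B (f x)) ->
  (forall x y, A x -> B y -> G (x, y) <-> y = f x) ->
  {within A, continuous f}.
Proof.
move=> cB cG AB GE; apply/subspace_continuousP => x Ax V nV.
have [//|nF] := pselect (within A (nbhs x) (f @^-1` V)).
pose C := A `&` f @^-1` (~` V).
have CF : ProperFilter (f @ within C (nbhs x)).
  split; last exact: fmap_filter.
  move=> C0; apply: nF.
  apply: (filterS _ (C0 : nbhs x (fun t => C t -> False))) => t Ct At.
  by apply: contrapT => nVt; apply: Ct.
have [|y [By cly]] := cB _ CF.
  by apply: (@filterS _ (nbhs x) _ setT _ _ filterT) => t _ [At _]; exact: AB.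
have Gxy : G (x, y).
  apply: cG => W [[P Q] /= [nP nQ] PQ].
  have fCP : (f @ within C (nbhs x)) (f @` (C `&` P)).
    by apply: (filterS _ nP) => t Pt Ct; exists t.
  have [_ [[s [[As Vs] Ps]] <- Qs]] := cly _ _ fCP nQ.
  exists (s, f s); split; last exact: PQ.
  by apply/GE => //; exact: AB.
move: cly; rewrite (iffLR (GE x y Ax By) Gxy) => cly.
have fV : (f @ within C (nbhs x)) (~` V).
  by apply: (@filterS _ (nbhs x) _ setT _ _ filterT) => t _ [].
by have [u []] := cly _ _ fV nV.
Qed.

(** * Hyperbolic distance in the Klein model *)

Lemma hdistC {R : realType} (p q : plane R) : hdist p q = hdist q p.
Proof.
rewrite /hdist; congr (arcosh (_ / Num.sqrt _)); last exact: mulrC.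
by rewrite /dotp; ring.
Qed.

Lemma hlineC {R : realType} (X Y : plane R) : hline Y X = hline X Y.
Proof.
have sub (U V : plane R) : hline U V `<=` hline V U.
  move=> _ [t /= + <-]; rewrite in_itv/= => /andP[t0 t1].
  exists (1 - t); first by rewrite /= in_itv/=; apply/andP; split; lra.
  by rewrite addrC subKr.
by rewrite eqEsubset; split; exact: sub.
Qed.

(** At the point p of parameter t, 1 - |p|^2 = t (1 - t) |X - Y|^2. *)
Lemma hline_hplane {R : realType} (Y X : plane R) :
  ideal X -> ideal Y -> Y <> X -> hline Y X `<=` hplane.
Proof.
case: X Y => a b [c d]; rewrite /ideal /hplane /dotp /= => X1 Y1 neq.
move=> [x y] [t]; rewrite /= in_itv/= => /andP[t0 t1] [xE yE].
have {xE}-> : x = (1 - t) * c + t * a by rewrite -xE.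
have {yE}-> : y = (1 - t) * d + t * b by rewrite -yE.
have lt0 : 0 < (a - c) ^+ 2 + (b - d) ^+ 2.
  rewrite lt_def paddr_eq0 ?sqr_ge0// addr_ge0 ?sqr_ge0// andbT.
  rewrite !sqrf_eq0 !subr_eq0; apply/negP => /andP[/eqP ac /eqP bd].
  by apply: neq; rewrite ac bd.
have : 0 < t * (1 - t) * ((a - c) ^+ 2 + (b - d) ^+ 2).
  by rewrite !mulr_gt0 ?subr_gt0.
have -> : t * (1 - t) * ((a - c) ^+ 2 + (b - d) ^+ 2) =
  t * (a * a + b * b) + (1 - t) * (c * c + d * d) -
  (((1 - t) * c + t * a) * ((1 - t) * c + t * a) +
   ((1 - t) * d + t * b) * ((1 - t) * d + t * b)) by ring.
by rewrite X1 Y1; lra.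
Qed.

(** The argument of [arcosh] is at least 1, because (1 - p.q)^2 - (1 - |p|^2)(1 - |q|^2) is (1 -
    |p|^2) |p - q|^2 + (p.(q - p))^2. *)
Lemma hdist_ge0 {R : realType} (p q : plane R) :
  hplane p -> hplane q -> 0 <= hdist p q.
Proof.
case: p q => a b [c d]; rewrite /hplane /hdist /arcosh /dotp /= => p1 q1.
set n := (X in _ / X); set m := 1 - _.
suff mn : 1 <= m / n.
  by apply: ln_ge0; apply: (le_trans mn); rewrite lerDl sqrtr_ge0.
have n0 : 0 < n by rewrite sqrtr_gt0 mulr_gt0 ?subr_gt0.
have m0 : 0 < m by rewrite /m; have := sqr_ge0 (a - c); have := sqr_ge0 (b - d);
  rewrite !expr2; lra.
rewrite ler_pdivlMr// mul1r -(@ler_pXn2r _ 2%N) ?nnegrE; last 3 first.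
- by [].
- exact: ltW.
- exact: ltW.
rewrite sqr_sqrtr; last by rewrite mulr_ge0 ?subr_ge0 ?ltW.
rewrite -subr_ge0.
have -> : m ^+ 2 - (1 - (a * a + b * b)) * (1 - (c * c + d * d)) =
  (1 - (a * a + b * b)) * ((a - c) ^+ 2 + (b - d) ^+ 2) +
  (a * (c - a) + b * (d - b)) ^+ 2 by rewrite /m; ring.
rewrite addr_ge0 ?sqr_ge0// mulr_ge0//; first by rewrite subr_ge0 ltW.
by rewrite addr_ge0 ?sqr_ge0.
Qed.

(** By compactness |p|^2 has a maximum r < 1 on [K], so the quotient inside [arcosh] is at most 2 /
    (1 - r). The bound makes the suprema in [side_dist] and [width] genuine: [sup] of an unbounded
    set is 0 by default. *)
Lemma hdist_bounded {R : realType} (K : set (plane R)) :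
  K `<=` hplane -> compact K ->
  exists M, forall p q, K p -> K q -> hdist p q <= M.
Proof.
move=> Kh cK.
have [[k Kk]|nK] := pselect (K !=set0); last first.
  by exists 0 => p q Kp; case: nK; exists p.
have cdot : {within K, continuous (fun p : plane R => dotp p p)}.
  apply: continuous_subspaceT => p; rewrite /dotp.
  by apply: cvgD; apply: cvgM; (exact: cvg_fst || exact: cvg_snd).
have [m /set_mem Km maxm] := compact_EVT_max (ex_intro _ k Kk) cK cdot.
set r := dotp m m in maxm; have r1 : r < 1 := Kh _ Km.
have C0 : 0 < 2 / (1 - r) by rewrite divr_gt0 ?subr_gt0.
exists (ln (2 / (1 - r) + Num.sqrt ((2 / (1 - r)) ^+ 2 - 1))) => p q Kp Kq.
have pr := maxm _ (mem_set Kp); have qr := maxm _ (mem_set Kq).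
have p1 := Kh _ Kp; have q1 := Kh _ Kq.
have pq0 : 0 < 1 - dotp p q.
  move: (p1) (q1); rewrite /hplane /dotp/= => ? ?.
  have := sqr_ge0 (p.1 - q.1); have := sqr_ge0 (p.2 - q.2).
  by rewrite !expr2; lra.
have pq2 : 1 - dotp p q <= 2.
  move: (p1) (q1); rewrite /hplane /dotp/= => ? ?.
  have := sqr_ge0 (p.1 + q.1); have := sqr_ge0 (p.2 + q.2).
  by rewrite !expr2; lra.
have s0 : 1 - r <= Num.sqrt ((1 - dotp p p) * (1 - dotp q q)).
  rewrite -[leLHS]gtr0_norm ?subr_gt0// -sqrtr_sqr ler_wsqrtr// expr2.
  by apply: ler_pM; rewrite ?subr_ge0 ?lerD2l ?lerN2// ltW.
have s1 : 0 < Num.sqrt ((1 - dotp p p) * (1 - dotp q q)).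
  by apply: lt_le_trans s0; rewrite subr_gt0.
have c0 : 0 < (1 - dotp p q) / Num.sqrt ((1 - dotp p p) * (1 - dotp q q)).
  exact: divr_gt0.
have cC : (1 - dotp p q) / Num.sqrt ((1 - dotp p p) * (1 - dotp q q)) <=
    2 / (1 - r).
  apply: ler_pM => //; first exact: ltW.
  by rewrite lef_pV2// posrE subr_gt0.
rewrite /hdist /arcosh ler_ln ?posrE ?ltr_wpDr ?sqrtr_ge0//.
by rewrite lerD// ler_wsqrtr// lerD2r ler_pXn2r ?nnegrE// ltW.
Qed.

Lemma set_hdist_ge0 {R : realType} (A B : set (plane R)) :
  A `<=` hplane -> B `<=` hplane -> 0 <= set_hdist A B.
Proof.
move=> Ah Bh; rewrite /set_hdist; set E := (X in inf X).
have [E0|nE] := pselect (E !=set0); last first.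
  suff -> : E = set0 by rewrite inf0.
  by rewrite eqEsubset; split => // x Ex; case: nE; exists x.
apply: lb_le_inf => // _ [p Ap [q Bq <-]].
by apply: hdist_ge0; [exact: Ah|exact: Bh].
Qed.

Lemma set_hdist_le {R : realType} {A B : set (plane R)} {p q : plane R} :
  A `<=` hplane -> B `<=` hplane -> A p -> B q -> set_hdist A B <= hdist p q.
Proof.
move=> Ah Bh Ap Bq; apply: ge_inf; last by exists p => //; exists q.
exists 0 => _ [p' Ap' [q' Bq' <-]].
by apply: hdist_ge0; [exact: Ah|exact: Bh].
Qed.

(** * Bounds for side distances, strips and the width *)

Lemma side_dist_ge0 {R : realType} (K : set (plane R)) (Y X : plane R) :
  K `<=` hplane -> ideal Y -> ideal X -> Y <> X -> 0 <= side_dist K Y X.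
Proof.
move=> Kh iY iX YX; rewrite /side_dist; set E := (X in sup X).
have [supE|/sup_out -> //] := pselect (has_sup E).
have [[x Ex] ubE] := supE; apply: le_trans (ub_le_sup ubE Ex).
case: Ex => p [Kp _] <-; apply: set_hdist_ge0; last exact: hline_hplane.
by move=> _ ->; exact: Kh.
Qed.

Lemma set_hdist_line_le {R : realType} (K : set (plane R)) (Y X p : plane R)
    (M : R) :
  K `<=` hplane -> (forall p q, K p -> K q -> hdist p q <= M) ->
  ideal Y -> ideal X -> Y <> X -> hline Y X `&` K !=set0 -> K p ->
  set_hdist [set p] (hline Y X) <= M.
Proof.
move=> Kh KM iY iX YX [q [Lq Kq]] Kp; apply: le_trans (KM _ _ Kp Kq).
apply: set_hdist_le => //; last exact: hline_hplane.
by move=> _ ->; exact: Kh.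
Qed.

Lemma side_dist_le {R : realType} (K : set (plane R)) (Y X : plane R) (M : R) :
  K `<=` hplane -> (forall p q, K p -> K q -> hdist p q <= M) ->
  ideal Y -> ideal X -> Y <> X -> hline Y X `&` K !=set0 ->
  side_dist K Y X <= M.
Proof.
move=> Kh KM iY iX YX LK; have [q [_ Kq]] := LK.
rewrite /side_dist; set E := (X in sup X).
(* If no point of [K] lies in this half-plane, the supremum is 0, and [M] is nonnegative because it
   bounds [hdist q q]. *)
have [E0|nE] := pselect (E !=set0); last first.
  suff -> : E = set0.
    by rewrite sup0 (le_trans _ (KM _ _ Kq Kq))// hdist_ge0//; exact: Kh.
  by rewrite eqEsubset; split => // x Ex; case: nE; exists x.
by apply: ge_sup => // _ [p [Kp _] <-]; exact: (@set_hdist_line_le _ K).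
Qed.

Lemma le_side_dist {R : realType} (K : set (plane R)) (Y X p : plane R) :
  K `<=` hplane -> compact K ->
  ideal Y -> ideal X -> Y <> X -> hline Y X `&` K !=set0 ->
  K p -> halfplane Y X p -> set_hdist [set p] (hline Y X) <= side_dist K Y X.
Proof.
move=> Kh cK iY iX YX LK Kp Hp; have [M KM] := hdist_bounded Kh cK.
apply: ub_le_sup; last by exists p.
by exists M => _ [q [Kq _] <-]; exact: (@set_hdist_line_le _ K).
Qed.

Lemma strip_width_le_width {R : realType} (K : set (plane R)) (Y X : plane R) :
  K `<=` hplane -> compact K ->
  ideal Y -> ideal X -> Y <> X -> hline Y X `&` K !=set0 ->
  strip_width K Y X <= width K X.
Proof.
move=> Kh cK iY iX YX LK; have [M KM] := hdist_bounded Kh cK.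
apply: ub_le_sup; last by exists Y.
exists (M + M) => _ [Z [iZ ZX LZ] <-]; apply: lerD; apply: side_dist_le => //.
  by move=> XZ; apply: ZX.
by rewrite hlineC.
Qed.

(** * Coordinates and chords of the disk *)

Lemma fst_comb {R : realType} (t s : R) (u v : plane R) :
  (t *: u + s *: v).1 = t * u.1 + s * v.1.
Proof. by []. Qed.

Lemma snd_comb {R : realType} (t s : R) (u v : plane R) :
  (t *: u + s *: v).2 = t * u.2 + s * v.2.
Proof. by []. Qed.

Lemma crossBB {R : realType} (p q u v : plane R) :
  cross (p - q) (u - v) =
  (p.1 - q.1) * (u.2 - v.2) - (p.2 - q.2) * (u.1 - v.1).
Proof. by []. Qed.

Lemma plane_eq {R : realType} (p q : plane R) :
  p.1 = q.1 -> p.2 = q.2 -> p = q.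
Proof. by case: p q => a b [c d] /= -> ->. Qed.

Lemma ideal_neq {R : realType} (X O : plane R) : ideal X -> hplane O -> O <> X.
Proof. by rewrite /ideal /hplane /= => X1 + OX; rewrite OX X1 ltxx. Qed.

Lemma dist2_gt0 {R : realType} (p q : plane R) :
  p <> q -> 0 < (p.1 - q.1) ^+ 2 + (p.2 - q.2) ^+ 2.
Proof.
move=> pq; rewrite lt_def paddr_eq0 ?sqr_ge0// addr_ge0 ?sqr_ge0// andbT.
rewrite !sqrf_eq0 !subr_eq0; apply/negP => /andP[/eqP ? /eqP ?].
by apply: pq; exact: plane_eq.
Qed.

Lemma one_sub_dotp_gt0 {R : realType} (X O : plane R) :
  ideal X -> hplane O -> 0 < 1 - dotp X O.
Proof.
rewrite /ideal /hplane /dotp /= => iX hO.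
have := sqr_ge0 (X.1 - O.1); have := sqr_ge0 (X.2 - O.2).
by rewrite !expr2; lra.
Qed.

Lemma ideal_chord {R : realType} (X O : plane R) : ideal X -> hplane O ->
  exists Y t, [/\ ideal Y, Y <> X, 0 < t < 1 & O = (1 - t) *: Y + t *: X].
Proof.
move=> iX hO; have n0 := dist2_gt0 (ideal_neq iX hO).
have m0 := one_sub_dotp_gt0 iX hO.
set n := (X in 0 < X) in n0; set m := (X in 0 < X) in m0.
(* With Y = X + (O - X) / s, the condition |Y| = 1 reads s = |X - O|^2 / (2 (1 - X.O)). Then s < 1
   amounts to |O| < 1. *)
pose s := n / (2 * m).
have s0 : 0 < s by rewrite divr_gt0// mulr_gt0.
have sm : s * (2 * m) = n by rewrite divfK// mulf_neq0// gt_eqF.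
have s1 : s < 1.
  rewrite ltr_pdivrMr ?mulr_gt0// mul1r /n /m !expr2.
  by move: iX hO; rewrite /ideal /hplane /dotp /=; lra.
pose Y : plane R := (X.1 + s^-1 * (O.1 - X.1), X.2 + s^-1 * (O.2 - X.2)).
have sV : s * s^-1 = 1 by rewrite divff// gt_eqF.
have OY : O = (1 - (1 - s)) *: Y + (1 - s) *: X.
  apply: plane_eq; rewrite ?fst_comb ?snd_comb /=.
    rewrite -[LHS]addr0 -[X in _ = X]addr0.
    have -> : (1 - (1 - s)) * (X.1 + s^-1 * (O.1 - X.1)) + (1 - s) * X.1 =
      s * s^-1 * (O.1 - X.1) + X.1 by ring.
    by rewrite sV; ring.
  have -> : (1 - (1 - s)) * (X.2 + s^-1 * (O.2 - X.2)) + (1 - s) * X.2 =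
    s * s^-1 * (O.2 - X.2) + X.2 by ring.
  by rewrite sV; ring.
exists Y, (1 - s); split => //.
- rewrite /ideal /dotp /=.
  have -> : (X.1 + s^-1 * (O.1 - X.1)) * (X.1 + s^-1 * (O.1 - X.1)) +
    (X.2 + s^-1 * (O.2 - X.2)) * (X.2 + s^-1 * (O.2 - X.2)) =
    dotp X X - 2 * s^-1 * (dotp X X - dotp X O) + s^-1 ^+ 2 * n.
    by rewrite /dotp /n; ring.
  rewrite (iX : dotp X X = 1) -sm -/m.
  have -> : 1 - 2 * s^-1 * m + s^-1 ^+ 2 * (s * (2 * m)) =
    1 - 2 * s^-1 * m + s^-1 * (s * s^-1) * (2 * m) by ring.
  by rewrite sV; ring.
- move=> YX; apply: (ideal_neq iX hO); rewrite OY YX -scalerDl.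
  by rewrite subrK scale1r.
- by apply/andP; split; lra.
Qed.

(** Here X - z = (1 - t)(X - Y), and p - z differs from p - Y by a multiple of X - Y. So the side of
    the line can be tested from [z] instead of the far end [Y]. *)
Lemma cross_chord {R : realType} (X Y z p : plane R) (t : R) :
  z = (1 - t) *: Y + t *: X ->
  cross (X - z) (p - z) = (1 - t) * cross (X - Y) (p - Y).
Proof. by move=> ->; rewrite !crossBB !fst_comb !snd_comb; ring. Qed.

(** * Supporting lines issuing from an ideal point *)

(* K lies to the left of the line directed from z to X. *)
Definition touches {R : realType} (K : set (plane R)) (X z : plane R) : Prop :=
  [/\ ideal X, K z & forall p, K p -> 0 <= cross (X - z) (p - z)].

(** [touches] relates [X] and [z] alone; the other end of the supporting line is recovered as the
    second end of the chord from [X] through [z]. *)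
Lemma touches_supporting {R : realType} (K : set (plane R)) (X z : plane R) :
  K `<=` hplane -> touches K X z ->
  exists Y, [/\ ideal Y, Y <> X, hline Y X z & K `<=` halfplane Y X].
Proof.
move=> Kh [iX Kz T]; have [Y [t [iY YX t01 zE]]] := ideal_chord iX (Kh _ Kz).
exists Y; split => //; first by exists t; rewrite /= ?in_itv.
move=> p Kp; split; first exact: Kh.
move: (T p Kp); rewrite (cross_chord _ zE) pmulr_rge0// subr_gt0.
by case/andP: t01.
Qed.

Lemma supporting_touches {R : realType} (K L : set (plane R)) (z : plane R) :
  supporting_at K z L ->
  exists Y X, [/\ touches K X z, ideal Y, Y <> X, L = hline Y X
    & K `<=` halfplane Y X].
Proof.
move=> [[Y [X [iY iX YX LE [KH _]]]] Kz Lz]; exists Y, X; split => //.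
split => // p Kp; move: Lz; rewrite LE => -[t /=]; rewrite in_itv/=.
move=> /andP[t0 t1] zE; rewrite (cross_chord _ (esym zE)).
by apply: mulr_ge0; [rewrite subr_ge0 ltW | case: (KH _ Kp)].
Qed.

Lemma interior_ray {R : realType} (K : set (plane R)) (m v : plane R) :
  interior K m -> exists2 e : R, 0 < e & K (m + e *: v).
Proof.
move=> Km.
have c : (fun e : R => m + e *: v) @ (0 : R) --> m.
  rewrite -[X in _ --> X](addr0 m) -(scale0r v).
  by apply: cvgD; [exact: cvg_cst | apply: cvgZr_tmp; exact: cvg_id].
have /nbhs_ballP[d /= d0 dK] := c _ Km.
exists (d / 2); first exact: divr_gt0.
apply: dK; rewrite -ball_normE /= sub0r normrN gtr0_norm ?divr_gt0//.
by rewrite ltr_pdivrMr// ltr_pMr// ltrDl.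
Qed.

(** A small step from [m] along [w] turned clockwise by a right angle stays in [K] and lands to the
    right of [w]. Hence a line with [K] on its left contains no interior point of [K]. *)
Lemma interior_cross {R : realType} (K : set (plane R)) (w m : plane R) :
  interior K m -> w <> 0 -> exists2 p, K p & cross w (p - m) < 0.
Proof.
move=> Km w0; have [e e0 Ke] := interior_ray (w.2, - w.1) Km.
exists (m + e *: (w.2, - w.1)) => //; rewrite addrAC subrr add0r.
have -> : cross w (e *: (w.2, - w.1)) = w.1 * (e * - w.1) - w.2 * (e * w.2).
  by [].
have d0 : 0 < w.1 ^+ 2 + w.2 ^+ 2 by have := dist2_gt0 w0; rewrite /= !subr0.
have -> : w.1 * (e * - w.1) - w.2 * (e * w.2) = - (e * (w.1 ^+ 2 + w.2 ^+ 2)).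
  by ring.
by rewrite oppr_lt0 mulr_gt0.
Qed.

Lemma touches_bd {R : realType} (K : set (plane R)) (X z : plane R) :
  K `<=` hplane -> touches K X z -> bd K z.
Proof.
move=> Kh [iX Kz T]; split; first exact: subset_closure.
move=> Iz; have [|p Kp] := @interior_cross _ _ (X - z) _ Iz.
  by move/subr0_eq => Xz; exact: (ideal_neq iX (Kh _ Kz)).
by rewrite ltNge T.
Qed.

Lemma touches_exists {R : realType} (K : set (plane R)) (X : plane R) :
  K `<=` hplane -> compact K -> K !=set0 -> ideal X -> exists z, touches K X z.
Proof.
move=> Kh cK K0 iX.
(* The slope of the line Xp relative to the radius at X; z minimizes it. *)
have cf : {within K, continuous (fun p : plane R =>
    cross X p / (1 - dotp X p))}.
  apply: continuous_in_subspaceT => p /set_mem Kp.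
  have nz : 1 - dotp X p != 0 by rewrite gt_eqF// one_sub_dotp_gt0//; exact: Kh.
  rewrite /cross /dotp; apply: cvgM.
    by apply: cvgB; (apply: cvgM; first exact: cvg_cst);
      (exact: cvg_fst || exact: cvg_snd).
  apply: cvgV => //; apply: cvgB; first exact: cvg_cst.
  by apply: cvgD; (apply: cvgM; first exact: cvg_cst);
    (exact: cvg_fst || exact: cvg_snd).
have [z /set_mem Kz zmin] := compact_EVT_min K0 cK cf.
exists z; split => // p Kp; have := zmin _ (mem_set Kp).
have z0 := one_sub_dotp_gt0 iX (Kh _ Kz).
have p0 := one_sub_dotp_gt0 iX (Kh _ Kp).
rewrite ler_pdivrMr// mulrAC ler_pdivlMr// -subr_ge0.
(* Since |X| = 1, the cross-multiplied comparison of the two slopes is exactly the sign of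
   [cross (X - z) (p - z)]. *)
have -> : cross X p * (1 - dotp X z) - cross X z * (1 - dotp X p) =
    cross X p - cross X z - dotp X X * cross z p.
  by rewrite /cross /dotp; ring.
rewrite (iX : dotp X X = 1); congr (0 <= _).
by rewrite crossBB /cross; ring.
Qed.

(** * Ideal point and point of contact determine each other *)

(** The midpoint of two contact points would be interior by strict convexity. But
    [cross (X - m) (p - m)] is affine in [m], so at the midpoint it is the mean of two nonnegative
    values, against [interior_cross]. *)
Lemma touches_point_unique {R : realType} (K : set (plane R))
    (X z z' : plane R) : K `<=` hplane -> strictly_convex K ->
  touches K X z -> touches K X z' -> z = z'.
Proof.
move=> Kh sK [iX Kz T] [_ Kz' T']; apply: contrapT => zz'.
have h01 : (0 < 2^-1 :> R) && (2^-1 < 1 :> R) by apply/andP; split; lra.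
have Im := sK _ _ _ Kz Kz' zz' h01.
set m := _ + _ in Im.
have Km : K m := interior_subset Im.
have [|p Kp] := @interior_cross _ _ (X - m) _ Im.
  by move/subr0_eq => Xm; exact: (ideal_neq iX (Kh _ Km)).
rewrite ltNge => /negP; apply.
have -> : cross (X - m) (p - m) =
  2^-1 * (cross (X - z) (p - z) + cross (X - z') (p - z')).
  by rewrite !crossBB !fst_comb !snd_comb; field.
by rewrite mulr_ge0 ?invr_ge0// addr_ge0 ?T ?T'.
Qed.

(** A ray from an inner point leaves the disk once: |z + l (X - z)|^2 = 1 is quadratic in [l], with
    the root 1 and a negative root, whence the factorization below. *)
Lemma ideal_ray_unique {R : realType} (X X' z : plane R) (l : R) :
  ideal X -> ideal X' -> hplane z -> 0 < l ->
  X'.1 - z.1 = l * (X.1 - z.1) -> X'.2 - z.2 = l * (X.2 - z.2) -> X = X'.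
Proof.
move=> iX iX' hz l0 E1 E2.
have A0 := dist2_gt0 (nesym (ideal_neq iX hz)); set A := (X in 0 < X) in A0.
have D0 : 0 < A * l + (1 - dotp z z).
  by rewrite addr_gt0 ?subr_gt0// mulr_gt0.
have : (l - 1) * (A * l + (1 - dotp z z)) = 0.
  have -> : (l - 1) * (A * l + (1 - dotp z z)) =
    ((z.1 + l * (X.1 - z.1)) * (z.1 + l * (X.1 - z.1)) +
     (z.2 + l * (X.2 - z.2)) * (z.2 + l * (X.2 - z.2)) - 1) -
    l * (dotp X X - 1) by rewrite /A /dotp; ring.
  rewrite -E1 -E2 (iX : dotp X X = 1) !subrKC.
  by rewrite -[X in X - 1]/(dotp X' X') (iX' : dotp X' X' = 1); ring.
move/eqP; rewrite mulf_eq0 [X in _ || X]gt_eqF// orbF subr_eq0 => /eqP l1.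
rewrite l1 !mul1r in E1 E2.
by apply: plane_eq; [rewrite (addIr _ E1)|rewrite (addIr _ E2)].
Qed.

(** Smoothness makes the two supporting lines at [z] equal, so [X] and [X'] are ends of one line
    through [z]. It remains to exclude that they are opposite ends. *)
Lemma touches_ideal_unique {R : realType} (K : set (plane R))
    (X X' z : plane R) : K `<=` hplane -> interior K !=set0 -> smooth_body K ->
  touches K X z -> touches K X' z -> X = X'.
Proof.
move=> Kh [m Im] smK TX TX'.
have [Y [iY YX Lz KH]] := touches_supporting Kh TX.
have [Y' [iY' YX' Lz' KH']] := touches_supporting Kh TX'.
have [iX Kz T] := TX; have [iX' _ T'] := TX'.
have sup_at U V : ideal U -> ideal V -> U <> V -> hline U V z ->
    K `<=` halfplane U V -> supporting_at K z (hline U V).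
  move=> iU iV UV LUz KUV; split => //; exists U, V; split => //.
  by split => //; exists z.
have [L [_ uL]] := smK z (touches_bd Kh TX).
have LL : hline Y' X' = hline Y X.
  rewrite -(uL _ (sup_at _ _ iY' iX' YX' Lz' KH')).
  by rewrite (uL _ (sup_at _ _ iY iX YX Lz KH)).
have [t /= + zE] := Lz; have [t' /= + zE'] := Lz'.
rewrite !in_itv/= => /andP[t'0 t'1] /andP[t0 t1].
(* [hline] omits its ends, so the equality of lines is applied to the midpoint q of [z] and [X']
   rather than to [X']. *)
have : hline Y X ((1 - (1 + t') / 2) *: Y' + ((1 + t') / 2) *: X').
  rewrite -LL; exists ((1 + t') / 2) => //=.
  by rewrite in_itv/=; apply/andP; split; lra.
move=> [s _ qE].
(* X' - z = 2 (q - z) = 2 (s - t)(X - Y), while X - z = (1 - t)(X - Y). *)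
pose l := 2 * (s - t) / (1 - t).
have lt : l * (1 - t) = 2 * (s - t) by rewrite divfK// subr_eq0 gt_eqF.
have E1 : X'.1 - z.1 = l * (X.1 - z.1).
  have := congr1 fst qE; rewrite !fst_comb => q1.
  have z1 : z.1 = (1 - t) * Y.1 + t * X.1 by rewrite -zE.
  have z1' : z.1 = (1 - t') * Y'.1 + t' * X'.1 by rewrite -zE'.
  have -> : l * (X.1 - z.1) = l * (1 - t) * (X.1 - Y.1) by rewrite z1; ring.
  rewrite lt; lra.
have E2 : X'.2 - z.2 = l * (X.2 - z.2).
  have := congr1 snd qE; rewrite !snd_comb => q2.
  have z2 : z.2 = (1 - t) * Y.2 + t * X.2 by rewrite -zE.
  have z2' : z.2 = (1 - t') * Y'.2 + t' * X'.2 by rewrite -zE'.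
  have -> : l * (X.2 - z.2) = l * (1 - t) * (X.2 - Y.2) by rewrite z2; ring.
  rewrite lt; lra.
(* [X' - z = l *: (X - z)]; if [l < 0], then K lies on both sides of one line. *)
have [l0|l0] := ltP 0 l; first exact: ideal_ray_unique (Kh _ Kz) l0 E1 E2.
have Xz0 : X - z <> 0.
  by move/subr0_eq => Xz; exact: (ideal_neq iX (Kh _ Kz)).
have T0 p : K p -> l * cross (X - z) (p - z) = 0.
  move=> Kp; apply/eqP; rewrite eq_le mulr_le0_ge0 ?T//=.
  have -> : l * cross (X - z) (p - z) = cross (X' - z) (p - z); last exact: T'.
  by rewrite !crossBB E1 E2; ring.
have ln0 : l != 0.
  apply/eqP => lz; apply: (ideal_neq iX' (Kh _ Kz)).
  by apply/esym/plane_eq; apply/subr0_eq; rewrite ?E1 ?E2 lz mul0r.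
have [p Kp] := interior_cross Im Xz0.
have -> : cross (X - z) (p - m) = cross (X - z) (p - z) - cross (X - z) (m - z).
  by rewrite !crossBB; ring.
have cr0 q : K q -> cross (X - z) (q - z) = 0.
  by move=> /T0/eqP; rewrite mulf_eq0 (negbTE ln0) => /eqP.
by rewrite !cr0 ?subrr ?ltxx//; exact: interior_subset.
Qed.

(** * Closedness of the contact relation and compactness of the ideal circle *)

Lemma cvg_cross {R : realType} (T : Type) (F : set_system T) {FF : Filter F}
    (f g : T -> plane R) (a b : plane R) :
  f @ F --> a -> g @ F --> b -> cross (f t) (g t) @[t --> F] --> cross a b.
Proof.
move=> fa gb.
have c1 (h : T -> plane R) (c : plane R) : h @ F --> c ->
    (h t).1 @[t --> F] --> c.1.
  by move=> hc; apply: (cvg_comp _ _ hc); exact: cvg_fst.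
have c2 (h : T -> plane R) (c : plane R) : h @ F --> c ->
    (h t).2 @[t --> F] --> c.2.
  by move=> hc; apply: (cvg_comp _ _ hc); exact: cvg_snd.
by rewrite /cross; apply: cvgB; apply: cvgM; (exact: c1 || exact: c2).
Qed.

(** Only the inequality of [touches] is kept, an intersection of closed conditions; membership of
    the two points is supplied by the domain and codomain in [closed_graph_within_continuous]. *)
Lemma closed_touch_graph {R : realType} (K : set (plane R)) :
  closed [set w : plane R * plane R |
    forall p, K p -> 0 <= cross (w.1 - w.2) (p - w.2)].
Proof.
have -> : [set w : plane R * plane R |
    forall p, K p -> 0 <= cross (w.1 - w.2) (p - w.2)] =
  \bigcap_(p in K) [set w | 0 <= cross (w.1 - w.2) (p - w.2)] by [].
apply: closed_bigI => p _.
apply: (@closed_comp _ _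
  (fun w : plane R * plane R => cross (w.1 - w.2) (p - w.2)) [set x | 0 <= x]);
  last exact: closed_ge.
move=> [X z] _.
apply: (@cvg_cross _ _ _ _ (fun w => w.1 - w.2) (fun w => p - w.2)).
  by apply: (@cvgB _ _ _ _ _ fst snd); [exact: cvg_fst|exact: cvg_snd].
by apply: (@cvgB _ _ _ _ _ (cst p) snd); [exact: cvg_cst|exact: cvg_snd].
Qed.

Lemma compact_ideal {R : realType} : compact (@ideal R).
Proof.
pose S : set R := `[-1, 1]%classic.
apply: (@subclosed_compact _ _ (S `*` S)).
- apply: (@closed_comp _ _ (fun p : plane R => dotp p p) [set 1]).
    move=> p _; rewrite /dotp.
    by apply: cvgD; apply: cvgM; (exact: cvg_fst || exact: cvg_snd).
  exact: closed_eq.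
- by apply: compact_setX; exact: segment_compact.
- move=> p; rewrite /ideal /dotp /= -!expr2 => p1.
  split; rewrite /S /= in_itv/= -ler_norml -(@ler_pXn2r _ 2%N)// ?nnegrE//.
    by rewrite expr1n real_normK ?num_real// -p1 lerDl sqr_ge0.
  by rewrite expr1n real_normK ?num_real// -p1 lerDr sqr_ge0.
Qed.

(** * Comparison of the widths and the homeomorphism *)

Lemma width1_le_side_dist {R : realType} (K : set (plane R))
    (Y X z : plane R) : K `<=` hplane -> compact K ->
  ideal Y -> ideal X -> Y <> X -> hline Y X z -> K z -> K `<=` halfplane Y X ->
  width1 K z (hline Y X) <= side_dist K Y X.
Proof.
move=> Kh cK iY iX YX Lz Kz KH; rewrite /width1 /opposite_support.
set P := (X in xget _ X).
have [exP|nP] := pselect (exists L', P L'); last first.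
  (* Junk value: the distance to the empty set is [inf set0 = 0]. *)
  rewrite xgetPN; last by move=> L' PL'; apply: nP; exists L'.
  rewrite /set_hdist; set E := (X in inf X).
  suff -> : E = set0 by rewrite inf0 side_dist_ge0.
  by rewrite eqEsubset; split => // x [p _ [q []]].
have [[U [V [iU iV UV -> [_ [v [Kv Lv]]]]]] _ _] := xgetPex set0 exP.
apply: le_trans (le_side_dist Kh cK iY iX YX _ Kv (KH _ Kv)); last first.
  by exists z.
(* [v] is a contact point of the opposite line, so each distance from [v] to a point of [hline Y X]
   competes in the infimum over both lines. *)
apply: lb_le_inf; first by exists (hdist v z), v => //; exists z.
move=> _ [_ -> [q Lq <-]]; rewrite hdistC.
by apply: set_hdist_le => //; exact: hline_hplane.
Qed.

Theorem mainTheorem5 (R : realType) (K : set (plane R)) (hK : convex_body K) :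
  (* (1) *)
  (forall X O : plane R, ideal X -> interior K O ->
     width3 K O X <= width K X) /\
  (* (2) *)
  (forall X : plane R, ideal X ->
     exists (z : plane R) (L : set (plane R)),
       [/\ bd K z, supporting_at K z L & width1 K z L <= width K X]) /\
  (* (3) *)
  (strictly_convex K -> smooth_body K ->
     exists phi : plane R -> plane R,
       homeo_between ideal (bd K) phi /\
       forall X : plane R, ideal X ->
         forall L : set (plane R), supporting_at K (phi X) L ->
           width1 K (phi X) L <= width K X).
Proof.
have [Kh cK _ [m Im]] := hK.
have K0 : K !=set0 by exists m; exact: interior_subset.
have width1_le (Y X z : plane R) : ideal Y -> ideal X -> Y <> X -> hline Y X z -> K z ->
    K `<=` halfplane Y X -> width1 K z (hline Y X) <= width K X.
  move=> iY iX YX Lz Kz KH.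
  apply: le_trans (strip_width_le_width Kh cK iY iX YX _); last by exists z.
  apply: le_trans (width1_le_side_dist Kh cK iY iX YX Lz Kz KH) _.
  by rewrite lerDl side_dist_ge0// => XY; apply: YX.
split; [|split].
- move=> X O iX IO; have KO : K O := interior_subset IO.
  have [iY YX rL] : [/\ ideal (other_end O X), other_end O X <> X &
      ray O X `<=` hline (other_end O X) X].
    apply: (@xgetPex _ X [set Y | [/\ ideal Y, Y <> X & ray O X `<=` hline Y X]]).
    have [Y [t [iY YX /andP[t0 t1] OE]]] := ideal_chord iX (Kh _ KO).
    exists Y; split => // _ [s /= + <-]; rewrite in_itv/= => /andP[s0 s1].
    (* The parameter on YX of (1 - s) O + s X when O = (1 - t) Y + t X. *)
    exists (t * (1 - s) + s).
      have : 0 < t * (1 - s) by rewrite mulr_gt0// subr_gt0.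
      have : 0 < (1 - t) * (1 - s) by rewrite mulr_gt0// subr_gt0.
      by rewrite /= in_itv/= => ? ?; apply/andP; split; lra.
    by rewrite OE; apply: plane_eq; rewrite ?fst_comb ?snd_comb; ring.
  apply: strip_width_le_width => //; exists O; split => //.
  apply: rL; exists 0; first by rewrite /= in_itv/= lexx ltr01.
  by rewrite subr0 scale1r scale0r addr0.
- move=> X iX; have [z TX] := touches_exists Kh cK K0 iX.
  have [Y [iY YX Lz KH]] := touches_supporting Kh TX.
  have [_ Kz _] := TX.
  exists z, (hline Y X); split; first exact: touches_bd TX.
    by split => //; exists Y, X; split => //; split => //; exists z.
  exact: width1_le.
move=> sK smK.
have bdK z : bd K z -> K z.
  move=> [+ _]; rewrite -(iffLR (closure_id K))//.
  by apply: compact_closed => //; exact: norm_hausdorff.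
(* Both maps are chosen from the contact relation; uniqueness in each variable makes them mutually
   inverse. *)
pose phi (X : plane R) := xget X [set z | touches K X z].
pose psi (z : plane R) := xget z [set X | touches K X z].
have phiP X : ideal X -> touches K X (phi X).
  by move=> iX; apply: (@xgetPex _ X [set z | touches K X z]);
    exact: touches_exists.
have psiP z : bd K z -> touches K (psi z) z.
  move=> bz; apply: (@xgetPex _ z [set X | touches K X z]).
  have [L [sL _]] := smK _ bz.
  by have [Y [X [TX _ _ _ _]]] := supporting_touches sL; exists X.
have phi_bd X : ideal X -> bd K (phi X).
  by move=> /phiP TX; exact: touches_bd TX.
have psi_ideal z : bd K z -> ideal (psi z) by move=> /psiP[].
exists phi; split.
  split.
  - split=> //.
      move=> X X' /set_mem iX /set_mem iX' XX'.
      have := phiP _ iX'; rewrite -XX'.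
      exact: (touches_ideal_unique Kh (ex_intro _ _ Im) smK (phiP _ iX)).
    move=> z bz; exists (psi z); first exact: psi_ideal.
    by apply: (touches_point_unique Kh sK (phiP _ (psi_ideal _ bz))); exact: psiP.
  (* The compact codomain is taken to be [K] itself, which contains [bd K]. *)
  - apply: (closed_graph_within_continuous cK (@closed_touch_graph _ K)).
      by move=> X /phiP[].
    move=> X z iX Kz; split => [G|->]; last by have [] := phiP _ iX.
    by apply: (touches_point_unique Kh sK _ (phiP _ iX)).
  - exists psi; split; last first.
      move=> X /set_mem iX.
      apply: (touches_ideal_unique Kh (ex_intro _ _ Im) smK _ (phiP _ iX)).
      exact: psiP (phi_bd _ iX).
    apply: (closed_graph_within_continuous compact_ideal
      (G := [set w | forall p, K p -> 0 <= cross (w.2 - w.1) (p - w.1)])) => //.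
      (* The graph of the inverse is the same closed relation with its coordinates swapped. *)
      rewrite (_ : [set _ | _] = unstable.swap @^-1` [set w : plane R * plane R |
        forall p, K p -> 0 <= cross (w.1 - w.2) (p - w.2)])//.
      apply: closed_comp (@closed_touch_graph _ K) => w _.
      exact: swap_continuous.
    move=> z X bz iX; split => [G|->]; last by have [] := psiP _ bz.
    apply: (touches_ideal_unique Kh (ex_intro _ _ Im) smK _ (psiP _ bz)).
    by split => //; exact: bdK.
move=> X iX L sL; have [Y [X' [TX' iY YX' LE KH]]] := supporting_touches sL.
(* An arbitrary supporting line at [phi X], directed so that [K] is on its left, ends at an ideal
   point touching there, which can only be [X]. *)
have XE : X' = X.
  exact: (touches_ideal_unique Kh (ex_intro _ _ Im) smK TX' (phiP _ iX)).
by case: sL => _ Kz; rewrite LE XE in YX' KH * => Lz; apply: width1_le.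
Qed.
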